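(* Fix an online cost-minimization problem, a length $n\ge 1$, and a greedy-like online algorithm $G$ for it. Suppose that for every $j$ with $1\le j\le n$, every online algorithm $A$ (over request sequences in $\mathcal{I}_n$) that is $G$-like on the suffix $[j+1,n]$ is also $G$-like extendable on $j$. Then $G$ is bijectively optimal on $\mathcal{I}_n$: for every online algorithm $B$ there exists a bijection $\pi:\mathcal{I}_n\to\mathcal{I}_n$ with $G(\sigma)\le B(\pi(\sigma))$ for all $\sigma\in\mathcal{I}_n$.
   Context: An online cost-minimization problem: requests arrive one at a time and an online algorithm must serve request $\sigma_i$ based only on $\sigma_1,\dots,\sigma_i$; $A(\sigma)$ denotes the total cost of algorithm $A$ on the sequence $\sigma$. $\mathcal{I}_n$ is the (finite) set of all request sequences of length $n$; $\sigma[i,j]$ denotes $\sigma_i\cdots\sigma_j$. An online algorithm is greedy-like if it serves each request $\sigma_i$ in a way that minimizes the cost objective assuming $\sigma_i$ is the final request. For the fixed greedy-like algorithm $G$ there is a (problem-specific) notion of an algorithm $A$ being $G$-like on $\sigma_i$: after having served $\sigma[1,i-1]$ (in whatever way), $A$ serves $\sigma_i$ as $G$ would. $A$ is $G$-like on the suffix $[j,n]$ if it serves all of $\sigma_j,\dots,\sigma_n$ in a $G$-like manner, for every $\sigma\in\mathcal{I}_n$. An online algorithm $A$ that is $G$-like on the suffix $[j+1,n]$ is called $G$-like extendable on $j$ if there exist a bijection $\pi:\mathcal{I}_n\to\mathcal{I}_n$ and an online algorithm $B$ such that: (1) for every $\sigma\in\mathcal{I}_n$, $B$ makes the same decisions as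 $A$ on the first $j-1$ requests of $\sigma$; (2) for every $\sigma\in\mathcal{I}_n$, $B$ is $G$-like on $\sigma_j$; (3) for every $\sigma\in\mathcal{I}_n$, $\pi(\sigma)[1,j]=\sigma[1,j]$ and $B(\pi(\sigma))\le A(\sigma)$. *)

(* Defs.v *)
From HB Require Import structures.
From mathcomp Require Import all_boot all_order all_algebra.

Set Implicit Arguments.
Unset Strict Implicit.
Unset Printing Implicit Defensive.

Import Order.TTheory GRing.Theory Num.Theory.
Local Open Scope ring_scope.

(* A history lists the requests served so far, each with the decision used to
   serve it.  [feasible h r d] means that, after history [h], request [r] may
   be served by decision [d]; [cost h] is the total cost of [h]. *)
Record online_problem (R : realDomainType) := OnlineProblem {
  request : finType;
  decision : Type;
  admissible : pred (seq request);
  feasible : seq (request * decision) -> request -> decision -> Prop;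
  cost : seq (request * decision) -> R
}.

Section OnlineProblem.

Variables (R : realDomainType) (P : online_problem R).

Definition history := seq (request P * decision P).

(* Responses are given at every history, not only at those the policy itself
   produces, so that "serve this request as G would" makes sense after
   arbitrary earlier decisions. *)
Definition policy := history -> request P -> decision P.

Definition run (A : policy) (s : seq (request P)) : history :=
  foldl (fun h r => rcons h (r, A h r)) [::] s.

Variable n : nat.

(* The set I_n. *)
Definition instance := {s : n.-tuple (request P) | admissible s}.

(* Indices are 0-based: [i : 'I_n] stands for the request sigma_(i+1). *)
Definition req (s : instance) (i : 'I_n) : request P := tnth (val s) i.

Definition history_before (A : policy) (s : instance) (i : 'I_n) : history :=
  run A (take i (val s)).

Definition decision_at (A : policy) (s : instance) (i : 'I_n) : decision P :=
  A (history_before A s i) (req s i).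

Record online_algorithm := OnlineAlgorithm {
  policy_of :> policy;
  policy_feasible : forall (s : instance) (i : 'I_n),
    feasible (history_before policy_of s i) (req s i) (decision_at policy_of s i)
}.

Implicit Types (A B G : online_algorithm) (s : instance).

Definition total_cost A s : R := cost (run A (val s)).

Definition greedy_like G : Prop :=
  forall s (i : 'I_n) (d : decision P),
    feasible (history_before G s i) (req s i) d ->
    cost (rcons (history_before G s i) (req s i, decision_at G s i))
      <= cost (rcons (history_before G s i) (req s i, d)).

(* The response of G is evaluated at the history of A, not at that of G. *)
Definition G_like_on G A s (i : 'I_n) : Prop :=
  decision_at A s i = policy_of G (history_before A s i) (req s i).

(* With 0-based [k], this is the suffix [k+1, n] of 1-based indices. *)
Definition G_like_on_suffix G A (k : nat) : Prop :=
  forall s (i : 'I_n), (k <= i)%N -> G_like_on G A s i.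

Definition G_like_extendable G A (j : 'I_n) : Prop :=
  exists (pi : instance -> instance) (B : online_algorithm),
    [/\ bijective pi,
        forall s (i : 'I_n), (i < j)%N -> decision_at B s i = decision_at A s i,
        forall s, G_like_on G B s j
      & forall s, take j.+1 (val (pi s)) = take j.+1 (val s)
                  /\ total_cost B (pi s) <= total_cost A s].

Definition bijectively_optimal G : Prop :=
  forall B, exists pi : instance -> instance,
    bijective pi /\ forall s, total_cost G s <= total_cost B (pi s).

End OnlineProblem.

(* Main.v *)
Require Import Defs.
From mathcomp Require Import all_boot all_order all_algebra.

Set Implicit Arguments.
Unset Strict Implicit.
Unset Printing Implicit Defensive.

Import Order.TTheory.
Local Open Scope ring_scope.

(** Making an algorithm G-like at request [k] may destroy its G-likeness at the
    later requests.  The induction therefore runs downward on [k] over all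
    algorithms at once: every [A] can be replaced, without raising its cost up
    to a bijection of the instances, by an algorithm with the same first [k]
    decisions that is G-like on all later requests.  The step applies the
    induction hypothesis, extends at [k], and applies the induction hypothesis
    again to repair the suffix.  For [k = 0] the resulting algorithm is [G]. *)

Section BijectiveOptimality.

Variables (R : realDomainType) (P : online_problem R) (n : nat).
Implicit Types (A B G : online_algorithm P n) (s : instance P n).

Lemma run_take_succ A s (i : 'I_n) :
  run A (take i.+1 (val s)) =
  rcons (history_before A s i) (req s i, decision_at A s i).
Proof.
have lt_is : (i < size (val (val s)))%N by rewrite size_tuple.
by rewrite (take_nth (req s i)) // /run -cats1 foldl_cat /= -tnth_nth.
Qed.

(** Decisions need comparing only where the histories already agree, so a rule such as responding
    like [G] at the current history can be used; induction on [k] supplies that agreement. *)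
Lemma eq_run_take A B s (k : nat) : (k <= n)%N ->
  (forall i : 'I_n, (i < k)%N -> history_before A s i = history_before B s i ->
     decision_at A s i = decision_at B s i) ->
  run A (take k (val s)) = run B (take k (val s)).
Proof.
elim: k => [|k IHk] le_kn eqAB; first by rewrite take0.
have eq_hist : history_before A s (Ordinal le_kn) =
               history_before B s (Ordinal le_kn).
  by apply: IHk => [|i lt_ik]; [apply: ltnW | apply: eqAB; apply: ltnW].
rewrite -[k.+1]/(Ordinal le_kn).+1 !run_take_succ eq_hist.
by rewrite (eqAB (Ordinal le_kn)).
Qed.

Lemma total_cost_G_like G A s :
  G_like_on_suffix G A 0 -> total_cost A s = total_cost G s.
Proof.
move=> GA; rewrite /total_cost -[X in run A X](take_size (val (val s))).
rewrite -[X in run G X](take_size (val (val s))) (@eq_run_take A G) //.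
  by rewrite size_tuple.
by move=> i _ eq_hist; rewrite GA // eq_hist.
Qed.

(** Whether an algorithm is G-like at [k] depends only on its decisions up to and including [k],
    since the earlier ones fix the history; so the property passes from [B] to [A]. *)
Lemma G_like_on_suffix_prepend G A B (k : 'I_n) :
    (forall s, G_like_on G B s k) ->
    (forall s (i : 'I_n), (i < k.+1)%N -> decision_at A s i = decision_at B s i) ->
  G_like_on_suffix G A k.+1 -> G_like_on_suffix G A k.
Proof.
move=> GB eqAB GA s i; rewrite leq_eqVlt => /orP[/eqP/val_inj <-|]; last exact: GA.
rewrite /G_like_on eqAB // GB; congr (policy_of G _ _).
apply/esym/eq_run_take => [|l lt_lk _]; first exact: ltnW.
by apply: eqAB; apply: ltnW.
Qed.

Definition cost_dominated B A : Prop :=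
  exists2 pi : instance P n -> instance P n,
    bijective pi & forall s, total_cost B (pi s) <= total_cost A s.

Lemma cost_dominated_refl A : cost_dominated A A.
Proof. by exists id => //; exists id. Qed.

Lemma cost_dominated_trans A B C :
  cost_dominated A B -> cost_dominated B C -> cost_dominated A C.
Proof.
move=> [f bij_f leAB] [g bij_g leBC]; exists (f \o g); first exact: bij_comp.
by move=> s; apply: le_trans (leBC s); apply: leAB.
Qed.

Lemma G_like_suffix_domination G :
    (forall (j : 'I_n) A,
       G_like_on_suffix G A j.+1 -> G_like_extendable G A j) ->
  forall k, (k <= n)%N -> forall A, exists B,
    [/\ forall s (i : 'I_n), (i < k)%N -> decision_at B s i = decision_at A s i,
        G_like_on_suffix G B k & cost_dominated B A].
Proof.
(* Downward induction on [k] becomes upward induction on [m = n - k]. At [m = 0] the suffix is empty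
   and [A] itself works. *)
move=> hext k le_kn; rewrite -(subKn le_kn).
elim: (n - k)%N (leq_subr k n) => {k le_kn} [_ A|m IHm lt_mn A].
  exists A; split=> // [s i|]; last exact: cost_dominated_refl.
  by rewrite subn0 leqNgt ltn_ord.
have lt_kn : (n - m.+1 < n)%N by rewrite ltn_subrL; apply: leq_trans lt_mn.
pose k := Ordinal lt_kn.
have {}IHm : forall A, exists B,
    [/\ forall s (i : 'I_n), (i < k.+1)%N -> decision_at B s i = decision_at A s i,
        G_like_on_suffix G B k.+1 & cost_dominated B A].
  by rewrite /= -subSn // subSS; apply: IHm; apply: ltnW.
have [A1 [eqA1 GA1 leA1]] := IHm A.
have [pi [B [bij_pi eqB GB leB]]] := hext k A1 GA1.
have [B1 [eqB1 GB1 leB1]] := IHm B.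
exists B1; split.
- move=> s i lt_ik; have le_ik : (i < k.+1)%N by apply: ltnW.
  by rewrite eqB1 // eqB // eqA1.
- exact: (@G_like_on_suffix_prepend G B1 B k).
- apply: cost_dominated_trans leB1 (cost_dominated_trans _ leA1).
  by exists pi => // s; have [] := leB s.
Qed.

End BijectiveOptimality.

Theorem theorem1 (R : realDomainType) (P : online_problem R) (n : nat)
    (hn : (1 <= n)%N) (G : online_algorithm P n) (hG : greedy_like G)
    (hext : forall (j : 'I_n) (A : online_algorithm P n),
       G_like_on_suffix G A j.+1 -> G_like_extendable G A j) :
  bijectively_optimal G.
Proof.
move=> B.
have [A [_ GA [pi [pi' piK pi'K] leAB]]] :=
  @G_like_suffix_domination R P n G hext 0 (leq0n n) B.
(* Domination bounds the cost of [A] on [pi s] by that of [B] on [s]; optimality permutes the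
   argument of [B], hence the inverse [pi']. *)
exists pi'; split=> [|s]; first by exists pi.
by rewrite -(total_cost_G_like s GA) -{1}(pi'K s).
Qed.
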